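(* Let $L\in\mathcal{L}(\mathcal{H},\mathcal{K})$, where $\mathcal{H}$ and $\mathcal{K}$ are Hilbert spaces and $\mathcal{K}=\mathcal{H}\oplus\cdots\oplus\mathcal{H}$ with $d$ summands. For each $j=1,\dots,d$, let $E_j\in\mathcal{L}(\mathcal{K},\mathcal{H})$ be the operator $E_j(h_1\oplus\cdots\oplus h_d)=h_j$. Suppose that $n=n_1+\cdots+n_d$ for some nonnegative integers $n_1,\dots,n_d$. Assume that $n\ge 2$, and set $$K=\sum E_{j_1}LE_{j_2}L\cdots E_{j_{n-1}}LE_{j_n},$$ where the summation is over all distinct arrangements $(j_1,j_2,\dots,j_n)$ of the tuple $$(\,\underbrace{1,\dots,1}_{n_1},\underbrace{2,\dots,2}_{n_2},\dots,\underbrace{d,\dots,d}_{n_d}\,).$$ Then $$\|K\|\le d^{(n-1)/2}\,\|L\|^{n-1}.$$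
   Context: $\mathcal{L}(\mathcal{X},\mathcal{Y})$ denotes the bounded linear operators from the Hilbert space $\mathcal{X}$ to the Hilbert space $\mathcal{Y}$, and norms are operator norms; $\mathcal{H}\oplus\cdots\oplus\mathcal{H}$ is the Hilbert space (orthogonal) direct sum. The sum has one term for each tuple $(j_1,\dots,j_n)\in\{1,\dots,d\}^n$ in which the value $i$ occurs exactly $n_i$ times, $i=1,\dots,d$. *)

(* Defs.v *)
From HB Require Import structures.
From mathcomp Require Import all_boot all_order all_algebra.
From mathcomp Require Import complex.
From mathcomp Require Import boolp classical_sets functions reals topology.
From mathcomp Require Import normedtype exp.

Set Implicit Arguments.
Unset Strict Implicit.
Unset Printing Implicit Defensive.

Import Order.TTheory GRing.Theory Num.Def Num.Theory.
Import numFieldNormedType.Exports.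

Local Open Scope classical_set_scope.
Local Open Scope ring_scope.
Local Open Scope complex_scope.

(* Complex Hilbert spaces over [R[i]]: complete normed modules whose norm comes
   from an inner product, linear in its first argument.  In MathComp-Analysis
   the norm of an [R[i]]-module takes its values in [R[i]]. *)
HB.mixin Record CompleteNormedModule_isHilbert (R : realType) V
    of CompleteNormedModule R[i] V := {
  hdot : {dot V for (@conjC R[i])};
  hdot_norm : forall x : V, hdot x x = `|x| ^+ 2
}.

#[short(type="hilbertType")]
HB.structure Definition Hilbert (R : realType) :=
  {V of CompleteNormedModule R[i] V & CompleteNormedModule_isHilbert R V}.

Section DotNorm.
Variables (C : numClosedFieldType) (U : lmodType C) (f : {dot U for (@conjC C)}).

Lemma dot_CauchySchwarz (u v : U) : `|f u v| ^+ 2 <= f u u * f v v.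
Proof.
have [->|v0] := eqVneq v 0; first by rewrite !linear0r normr0 expr0n mulr0.
pose a := f u v / f v v; pose w := u - a *: v.
have vv0 : f v v != 0 by rewrite dnorm_eq0.
have wv : f w v = 0 by rewrite linearBl/= linearZl_LR/= divfK ?subrr.
have -> : f u u = f w w + `|a| ^+ 2 * f v v.
  rewrite -[in LHS](subrK (a *: v) u) -/w hnormDd; last first.
    by rewrite /= linearZr_LR/= wv mulr0.
  by rewrite -dnormZ.
have -> : `|f u v| ^+ 2 = `|a| ^+ 2 * f v v * f v v.
  by rewrite -[in LHS](divfK vv0 (f u v)) -/a normrM exprMn
    (ger0_norm (dnorm_ge0 _ _)) -mulrA.
by rewrite mulrDl lerDr mulr_ge0 ?dnorm_ge0.
Qed.

Lemma dot_ler_normD (u v : U) :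
  sqrtC (f (u + v) (u + v)) <= sqrtC (f u u) + sqrtC (f v v).
Proof.
have ge0 w : 0 <= f w w by exact: dnorm_ge0.
have sge0 w : 0 <= sqrtC (f w w) by rewrite sqrtC_ge0.
rewrite -(@ler_pXn2r _ 2) ?nnegrE ?addr_ge0// sqrtCK sqrrD !sqrtCK dnormD/=.
rewrite addrAC lerD2r lerD2l.
apply: (le_trans (real_ler_norm _)).
  by rewrite CrealE rmorphD/= conjCK addrC.
apply: (le_trans (ler_normD _ _)); rewrite norm_conjC -mulr2n.
apply: ler_wMn2r; rewrite -(@ler_pXn2r _ 2) ?nnegrE ?mulr_ge0//.
by rewrite exprMn !sqrtCK dot_CauchySchwarz.
Qed.

End DotNorm.

(* The orthogonal direct sum of [d] copies of [H], with inner product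
   <x, y> = \sum_i <x_i, y_i>. *)
Definition hsum (R : realType) (d : nat) (H : hilbertType R) : Type :=
  {ffun 'I_d -> H}.

Section HilbertSum.
Variables (R : realType) (d : nat) (H : hilbertType R).
Local Notation K := (hsum d H).

HB.instance Definition _ := GRing.Lmodule.copy K {ffun 'I_d -> H}.

Definition hsum_coord (x : K) (i : 'I_d) : H := (x : {ffun 'I_d -> H}) i.

Lemma hsum_coordD (x y : K) i :
  hsum_coord (x + y) i = hsum_coord x i + hsum_coord y i.
Proof. by rewrite /hsum_coord ffunE. Qed.

Lemma hsum_coordZ (a : R[i]) (x : K) i :
  hsum_coord (a *: x) i = a *: hsum_coord x i.
Proof. by rewrite /hsum_coord ffunE. Qed.

Lemma hsum_coordB (x y : K) i :
  hsum_coord (x - y) i = hsum_coord x i - hsum_coord y i.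
Proof. by rewrite /hsum_coord !ffunE. Qed.

Definition hsum_dot (x y : K) : R[i] :=
  \sum_i hdot (hsum_coord x i) (hsum_coord y i).

Lemma hsum_dot_bilinear :
  bilinear_for (GRing.Scale.Law.clone _ _ ( *%R) _)
    (GRing.Scale.Law.clone _ _ (@conjC R[i] \; *%R) _) hsum_dot.
Proof.
split=> [v a x y|u a x y]; rewrite /hsum_dot/= mulr_sumr -big_split/=;
  apply: eq_bigr => i _; rewrite hsum_coordD hsum_coordZ.
- by rewrite linearDl/= linearZl_LR.
- by rewrite linearDr/= linearZr_LR.
Qed.

HB.instance Definition _ := bilinear_isBilinear.Build R[i] K K R[i] _ _
  hsum_dot hsum_dot_bilinear.

Lemma hsum_dot_hermitian (x y : K) :
  hsum_dot x y = (-1) ^+ false * (hsum_dot y x)^*.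
Proof.
rewrite expr0 mul1r /hsum_dot rmorph_sum; apply: eq_bigr => i _ /=.
by rewrite hermC/= expr0 mul1r.
Qed.

HB.instance Definition _ :=
  isHermitianSesquilinear.Build R[i] K false (@conjC R[i]) hsum_dot
    hsum_dot_hermitian.

Lemma hsum_dot_gt0 (x : K) : x != 0 -> 0 < hsum_dot x x.
Proof.
move=> x0; rewrite lt_def sumr_ge0 ?andbT => [|i _]; last exact: dnorm_ge0.
apply: contra x0; rewrite psumr_eq0 => [|i _]; last exact: dnorm_ge0.
move=> /allP xi0; apply/eqP/ffunP => i; rewrite ffunE.
by apply/eqP; rewrite -(dnorm_eq0 hdot); apply: xi0; rewrite mem_index_enum.
Qed.

HB.instance Definition _ := isDotProduct.Build R[i] K hsum_dot hsum_dot_gt0.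

Definition hsum_norm (x : K) : R[i] := sqrtC (hsum_dot x x).

Lemma hsum_ler_normD x y : hsum_norm (x + y) <= hsum_norm x + hsum_norm y.
Proof. exact: (dot_ler_normD hsum_dot). Qed.

Lemma hsum_normrZ (a : R[i]) x : hsum_norm (a *: x) = `|a| * hsum_norm x.
Proof.
by rewrite /hsum_norm (dnormZ hsum_dot) sqrtCM ?nnegrE ?exprn_ge0 ?sqrCK//.
Qed.

Lemma hsum_normr0_eq0 x : hsum_norm x = 0 -> x = 0.
Proof.
by move=> /eqP; rewrite /hsum_norm (sqrt_dnorm_eq0 hsum_dot) => /eqP.
Qed.

HB.instance Definition _ := Lmodule_isNormed.Build R[i] K
  hsum_ler_normD hsum_normrZ hsum_normr0_eq0.

Lemma hsum_hdot_norm (x : K) : hsum_dot x x = `|x| ^+ 2.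
Proof. by rewrite [`|x|]/(hsum_norm x) sqrtCK. Qed.

Lemma hsum_norm_sqr (x : K) : `|x| ^+ 2 = \sum_i `|hsum_coord x i| ^+ 2.
Proof. by rewrite -hsum_hdot_norm; apply: eq_bigr => i _; rewrite hdot_norm. Qed.

Lemma hsum_coord_le (x : K) i : `|hsum_coord x i| <= `|x|.
Proof.
rewrite -(@ler_pXn2r _ 2) ?nnegrE// hsum_norm_sqr (bigD1 i)//= lerDl.
by rewrite sumr_ge0// => j _; rewrite exprn_ge0.
Qed.

Lemma hsum_norm_le (x : K) : `|x| <= \sum_i `|hsum_coord x i|.
Proof.
have ge0 : 0 <= \sum_i `|hsum_coord x i| by rewrite sumr_ge0.
rewrite -(@ler_pXn2r _ 2) ?nnegrE// hsum_norm_sqr expr2 mulr_suml.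
apply: ler_sum => i _; rewrite expr2 ler_wpM2l// (bigD1 i)//= lerDl.
by rewrite sumr_ge0.
Qed.

Lemma hsum_cauchy_cvg (F : set_system K) :
  ProperFilter F -> cauchy F -> cvg F.
Proof.
move=> FF /cauchyP Fc.
have ci i : cvg (hsum_coord ^~ i @ F).
  apply: cauchy_cvg; apply/cauchy_exP => e e0.
  have [x Fx] := Fc e e0.
  exists (hsum_coord x i).
  change (F [set y | ball (hsum_coord x i) e (hsum_coord y i)]).
  apply: filterS Fx => y /=.
  rewrite -!ball_normE/= -hsum_coordB; exact: le_lt_trans (hsum_coord_le _ _).
pose l : K := [ffun i => lim (hsum_coord ^~ i @ F)].
apply/cvg_ex; exists l; apply/cvgrPdist_lt => e e0.
have e0' : 0 < e / d.+1%:R by rewrite divr_gt0 ?ltr0n.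
have : \forall x \near F, forall i, `|hsum_coord (l - x) i| < e / d.+1%:R.
  apply: filter_forall => i.
  have /cvgrPdist_lt/(_ _ e0') := ci i.
  by apply: filterS => x; rewrite hsum_coordB [hsum_coord l i]ffunE.
apply: filterS => x lx; apply: (le_lt_trans (hsum_norm_le _)).
apply: (@le_lt_trans _ _ (\sum_(i < d) e / d.+1%:R)).
  by apply: ler_sum => i _; exact/ltW.
rewrite sumr_const card_ord -[ltLHS]mulr_natr -mulrA gtr_pMr// mulrC.
by rewrite ltr_pdivrMr ?ltr0n// mul1r ltr_nat.
Qed.

HB.instance Definition _ := Uniform_isComplete.Build K hsum_cauchy_cvg.

HB.instance Definition _ :=
  CompleteNormedModule_isHilbert.Build R K hsum_hdot_norm.

End HilbertSum.

(* The space L(U, V) of bounded linear operators. *)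
Record blinop (C : numFieldType) (U V : normedModType C) := Blinop {
  blinop_fun :> U -> V;
  blinop_linear : linear blinop_fun;
  blinop_bounded : exists M : C, forall x, `|blinop_fun x| <= M * `|x|
}.

Section BoundedOperators.
Variables (C : numFieldType).
Implicit Types U V W : normedModType C.

HB.instance Definition _ U V (f : blinop U V) :=
  GRing.isLinear.Build C U V _ f (blinop_linear f).

Lemma blinopP U V (f g : blinop U V) : f =1 g -> f = g.
Proof.
case: f g => [f fl fb] [g gl gb]/= /funext fg; case: _ / fg in gl gb *.
by congr Blinop; exact: Prop_irrelevance.
Qed.

HB.instance Definition _ U V := gen_eqMixin (blinop U V).
HB.instance Definition _ U V := gen_choiceMixin (blinop U V).

Lemma blinop_ge0_bounded U V (f : blinop U V) :
  exists2 M : C, 0 <= M & forall x, `|f x| <= M * `|x|.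
Proof.
have [M fM] := blinop_bounded f; exists `|M| => // x.
have [->|x0] := eqVneq x 0; first by rewrite linear0 !normr0 mulr0.
have M0 : 0 <= M.
  by rewrite -(pmulr_lge0 _ (_ : 0 < `|x|)) ?normr_gt0// (le_trans _ (fM x)).
by rewrite ger0_norm.
Qed.

Section Operations.
Variables U V W : normedModType C.

Fact blinop0_linear : linear (fun _ : U => 0 : V).
Proof. by move=> a x y; rewrite scaler0 addr0. Qed.
Fact blinop0_bounded : exists M : C, forall x : U, `|0 : V| <= M * `|x|.
Proof. by exists 0 => x; rewrite normr0 mul0r. Qed.
Definition blinop0 := Blinop blinop0_linear blinop0_bounded.

Fact blinop_opp_linear (f : blinop U V) : linear (fun x => - f x).
Proof. by move=> a x y; rewrite linearP opprD scalerN. Qed.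
Fact blinop_opp_bounded (f : blinop U V) :
  exists M : C, forall x, `|- f x| <= M * `|x|.
Proof.
by have [M fM] := blinop_bounded f; exists M => x; rewrite normrN.
Qed.
Definition blinop_opp f := Blinop (blinop_opp_linear f) (blinop_opp_bounded f).

Fact blinop_add_linear (f g : blinop U V) : linear (fun x => f x + g x).
Proof. by move=> a x y; rewrite !linearP scalerDr addrACA. Qed.
Fact blinop_add_bounded (f g : blinop U V) :
  exists M : C, forall x, `|f x + g x| <= M * `|x|.
Proof.
have [M fM] := blinop_bounded f; have [N gN] := blinop_bounded g.
by exists (M + N) => x; rewrite mulrDl (le_trans (ler_normD _ _))// lerD.
Qed.
Definition blinop_add f g :=
  Blinop (blinop_add_linear f g) (blinop_add_bounded f g).

Fact blinop_comp_linear (f : blinop V W) (g : blinop U V) :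
  linear (fun x => f (g x)).
Proof. by move=> a x y; rewrite !linearP. Qed.
Fact blinop_comp_bounded (f : blinop V W) (g : blinop U V) :
  exists M : C, forall x, `|f (g x)| <= M * `|x|.
Proof.
have [M M0 fM] := blinop_ge0_bounded f; have [N gN] := blinop_bounded g.
by exists (M * N) => x; rewrite (le_trans (fM _))// -mulrA ler_wpM2l.
Qed.
Definition blinop_comp f g :=
  Blinop (blinop_comp_linear f g) (blinop_comp_bounded f g).

Fact blinop_addA : associative blinop_add.
Proof. by move=> f g h; apply: blinopP => x /=; rewrite addrA. Qed.
Fact blinop_addC : commutative blinop_add.
Proof. by move=> f g; apply: blinopP => x /=; rewrite addrC. Qed.
Fact blinop_add0 : left_id blinop0 blinop_add.
Proof. by move=> f; apply: blinopP => x /=; rewrite add0r. Qed.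
Fact blinop_addN : left_inverse blinop0 blinop_opp blinop_add.
Proof. by move=> f; apply: blinopP => x /=; rewrite addNr. Qed.

HB.instance Definition _ := GRing.isZmodule.Build (blinop U V)
  blinop_addA blinop_addC blinop_add0 blinop_addN.

End Operations.
End BoundedOperators.

Notation "f \oB g" := (blinop_comp f g)
  (at level 50, left associativity, format "f  \oB  g").

Lemma blinop_sumE (C : numFieldType) (U V : normedModType C) (I : Type)
    (r : seq I) (P : pred I) (F : I -> blinop U V) (x : U) :
  (\sum_(i <- r | P i) F i) x = \sum_(i <- r | P i) F i x.
Proof.
by elim/big_ind2 : _ => // f u g v <- <-.
Qed.

Section OperatorNorm.
Variables (R : realType) (U V : normedModType R[i]).
Local Open Scope classical_set_scope.

(* ||f|| = sup {||f x|| : ||x|| <= 1}; [Re] only casts the norm, a nonnegative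
   element of [R[i]], to [R]. *)
Definition opnorm (f : blinop U V) : R :=
  sup [set complex.Re `|f x| | x in [set x : U | `|x| <= 1]]%classic.

Lemma opnorm_has_sup (f : blinop U V) :
  has_sup [set complex.Re `|f x| | x in [set x : U | `|x| <= 1]].
Proof.
split; first by exists (complex.Re `|f 0|); exists 0 => //=; rewrite normr0.
have [M M0 fM] := blinop_ge0_bounded f.
exists (complex.Re M) => _ [x /= x1 <-].
have : `|f x| <= M by rewrite (le_trans (fM x))// ler_piMr.
by rewrite lecE => /andP[].
Qed.

Lemma opnorm_ub (f : blinop U V) x : `|x| <= 1 -> `|f x| <= (opnorm f)%:C.
Proof.
move=> x1; rewrite -[leLHS]RRe_real ?normr_real// lecR.
by apply: (sup_upper_bound (opnorm_has_sup f)); exists x.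
Qed.

Lemma opnorm_ge0 (f : blinop U V) : 0 <= opnorm f.
Proof.
rewrite -lecR; apply: le_trans (opnorm_ub f (x := 0) _) => //.
by rewrite normr0.
Qed.

Lemma opnormP (f : blinop U V) x : `|f x| <= (opnorm f)%:C * `|x|.
Proof.
have [->|x0] := eqVneq x 0; first by rewrite linear0 !normr0 mulr0.
rewrite -ler_pdivrMr ?normr_gt0// mulrC.
have -> : `|x|^-1 * `|f x| = `|f (`|x|^-1 *: x)|.
  by rewrite linearZ/= normrZ normfV normr_id.
by apply: opnorm_ub; rewrite normfZV.
Qed.

Lemma opnorm_le (f : blinop U V) (M : R) : 0 <= M ->
  (forall x, `|f x| <= M%:C * `|x|) -> opnorm f <= M.
Proof.
move=> M0 fM; apply: ge_sup; first by case: (opnorm_has_sup f).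
move=> _ [x /= x1 <-]; rewrite -lecR RRe_real ?normr_real// (le_trans (fM x))//.
by rewrite ler_piMr// lecR.
Qed.

End OperatorNorm.

Section Words.
Variables (R : realType) (d : nat) (H : hilbertType R).
Local Notation K := (hsum d H).

Fact hsum_coord_linear (j : 'I_d) : linear (hsum_coord (H := H) ^~ j).
Proof. by move=> a x y; rewrite hsum_coordD hsum_coordZ. Qed.
Fact hsum_coord_bounded (j : 'I_d) :
  exists M : R[i], forall x : K, `|hsum_coord x j| <= M * `|x|.
Proof. by exists 1 => x; rewrite mul1r hsum_coord_le. Qed.

Definition hproj (j : 'I_d) : blinop K H :=
  Blinop (hsum_coord_linear j) (hsum_coord_bounded j).

(* E_{j_1} L E_{j_2} L ... L E_{j_n} for [s = [:: j_1; ...; j_n]], where E_j is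
   [hproj j]; the empty word, for which no such product exists, gets the junk
   value 0. *)
Fixpoint word_op (L : blinop H K) (s : seq 'I_d) : blinop K H :=
  match s with
  | [::] => 0
  | [:: j] => hproj j
  | j :: s' => hproj j \oB L \oB word_op L s'
  end.

End Words.

(* Main.v *)
Require Import Defs.
From HB Require Import structures.
From mathcomp Require Import all_boot all_order all_algebra.
From mathcomp Require Import complex.
From mathcomp Require Import boolp classical_sets functions reals topology.
From mathcomp Require Import normedtype exp.

Set Implicit Arguments.
Unset Strict Implicit.
Unset Printing Implicit Defensive.

Import Order.TTheory GRing.Theory Num.Theory.
Import numFieldNormedType.Exports.

Local Open Scope ring_scope.

(* With T_j = E_j L, the identity \sum_j |T_j h|^2 = |L h|^2 <= |L|^2 |h|^2
   gives by induction that the squares of the norms of all words of length n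
   applied to x sum to at most |L|^(2(n-1)) |x|^2.  By Cauchy-Schwarz |K x|^2
   is at most this bound times the number of arrangements, and this number is
   at most d^(n-1) because n-1 letters of an arrangement determine the
   remaining one. *)

(** Sum [a i * a j <= (a i ^+ 2 + a j ^+ 2) / 2] over all pairs. *)
Lemma sqr_sum_le (F : numFieldType) (I : finType) (P : pred I) (a : I -> F) :
  (forall i, P i -> 0 <= a i) ->
  (\sum_(i | P i) a i) ^+ 2 <= #|P|%:R * \sum_(i | P i) a i ^+ 2.
Proof.
move=> a0.
have -> : #|P|%:R * \sum_(i | P i) a i ^+ 2 =
    \sum_(i | P i) \sum_(j | P j) (a i ^+ 2 + a j ^+ 2) / 2.
  under [RHS]eq_bigr do rewrite -mulr_suml big_split/= sumr_const.
  rewrite -mulr_suml big_split/= sumr_const -sumrMnl -mulr2n.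
  by rewrite -[_ *+ 2]mulr_natr mulfK ?pnatr_eq0// sumrMnl mulr_natl.
rewrite expr2 mulr_suml; apply: ler_sum => i Pi.
rewrite mulr_sumr; apply: ler_sum => j Pj.
rewrite ler_pdivlMr ?ltr0n// -subr_ge0.
have -> : a i ^+ 2 + a j ^+ 2 - a i * a j * 2 = (a i - a j) ^+ 2.
  by rewrite sqrrB mulr_natr addrAC.
(* Squares need not be nonnegative in [F]; here the base is real because the [a i] are
   nonnegative. *)
by rewrite real_exprn_even_ge0// rpredB// ger0_real ?a0.
Qed.

Lemma card_arrangements (d n : nat) (m : 'I_d -> nat) :
  (#|[pred j : n.+1.-tuple 'I_d | [forall i, count_mem i j == m i]]|
    <= d ^ n)%N.
Proof.
have -> : (d ^ n = #|{: n.-tuple 'I_d}|)%N by rewrite card_tuple card_ord.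
pose f (j : n.+1.-tuple 'I_d) : n.-tuple 'I_d := [tuple of behead j].
apply: (@leq_card_in _ _ f) => s t.
case/tupleP: s => a s; case/tupleP: t => b t.
rewrite !inE => /forallP/(_ a)/eqP/= sa /forallP/(_ a)/eqP/= ta /(congr1 val)/=.
move=> st; apply: val_inj => /=; rewrite st; congr cons.
(* Counting the letter [a] in both words and cancelling the common tail leaves
   [(a == a) = (b == a)]. *)
move: sa; rewrite -ta st eqxx => /addIn; by case: eqP.
Qed.

Lemma sum_sqr_word_op (R : realType) (d n : nat) (H : hilbertType R)
    (L : blinop H (hsum d H)) (x : hsum d H) :
  \sum_(j : n.+1.-tuple 'I_d) `|word_op L j x| ^+ 2
  <= ((opnorm L)%:C)%C ^+ (n * 2) * `|x| ^+ 2.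
Proof.
have tupleS k (G : seq 'I_d -> R[i]) : \sum_(j : k.+1.-tuple 'I_d) G j =
    \sum_(t : k.-tuple 'I_d) \sum_(a : 'I_d) G (a :: t).
  rewrite pair_big/=.
  rewrite (reindex (fun p : k.-tuple 'I_d * 'I_d => [tuple of p.2 :: p.1]))//=.
  exists (fun j : k.+1.-tuple 'I_d => ([tuple of behead j], thead j)) =>
    [[t a] _|j _] /=.
    by congr pair; exact: val_inj.
  by rewrite [RHS]tuple_eta.
elim: n => [|n IH].
  rewrite (tupleS _ (fun s => `|word_op L s x| ^+ 2)).
  rewrite (big_pred1 [tuple]) => [|t]; last exact/esym/eqP/tuple0.
  by rewrite mul0n expr0 mul1r hsum_norm_sqr.
rewrite (tupleS _ (fun s => `|word_op L s x| ^+ 2)) mulSn exprD -mulrA.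
apply: le_trans (ler_wpM2l _ IH); last by rewrite exprn_ge0// lecR opnorm_ge0.
(* The tail is nonempty, so [word_op] unfolds to a composition. As the first letter varies, the
   terms are the squared coordinates of [L] applied to the value of the tail at [x], and they add up
   to its squared norm. *)
rewrite mulr_sumr; apply: ler_sum => -[[|b s]//= _] _.
rewrite -[leLHS]hsum_norm_sqr -exprMn.
by rewrite lerXn2r ?nnegrE ?mulr_ge0 ?lecR ?opnorm_ge0// opnormP.
Qed.

Theorem lemma11 (R : realType) (H : hilbertType R) (d n : nat)
    (L : blinop H (hsum d H)) (m : 'I_d -> nat)
    (n_sum : n = (\sum_(i < d) m i)%N) (n_ge2 : (2 <= n)%N) :
  opnorm (\sum_(j : n.-tuple 'I_d | [forall i, count_mem i j == m i])
            word_op L j)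
  <= d%:R `^ (n.-1%:R / 2) * opnorm L ^+ n.-1.
Proof.
(* From here on words have length [n.+1], and [n] counts the factors [L]. *)
case: n n_ge2 {n_sum} => // n _ /=.
have M0 : 0 <= (d%:R : R) `^ (n%:R / 2) * opnorm L ^+ n.
  by rewrite mulr_ge0 ?powR_ge0 ?exprn_ge0 ?opnorm_ge0.
apply: opnorm_le => // x; rewrite blinop_sumE.
rewrite -(@ler_pXn2r _ 2) ?nnegrE ?mulr_ge0 ?lecR//.
have -> : ((((d%:R : R) `^ (n%:R / 2) * opnorm L ^+ n)%:C)%C * `|x|) ^+ 2 =
    (d ^ n)%:R * (((opnorm L)%:C)%C ^+ (n * 2) * `|x| ^+ 2).
  rewrite exprMn mulrA; congr (_ * _).
  rewrite -rmorphXn exprMn -[(_ `^ _) ^+ 2]powR_mulrn ?powR_ge0// -powRrM divfK ?pnatr_eq0//.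
  by rewrite powR_mulrn// -exprM rmorphM !rmorphXn/= rmorph_nat.
set P := fun j : n.+1.-tuple 'I_d => [forall i, count_mem i j == m i].
apply: (@le_trans _ _ ((\sum_(j | P j) `|word_op L j x|) ^+ 2)).
  by rewrite lerXn2r ?nnegrE ?sumr_ge0// ler_norm_sum.
apply: (le_trans (sqr_sum_le _)) => //.
apply: ler_pM; rewrite ?sumr_ge0 ?ler_nat ?card_arrangements//.
  by move=> j _; rewrite exprn_ge0.
(* Enlarging the sum from arrangements to all words only adds nonnegative terms. *)
apply: le_trans (sum_sqr_word_op n L x).
rewrite [leRHS](bigID P)/= lerDl sumr_ge0// => j _.
by rewrite exprn_ge0.
Qed.
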